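(* Let $\mathsf a=(\mathsf a_{\ell,\ell'})_{\ell,\ell'\ge0}$ and $\mathsf b=(\mathsf b_\ell)_{\ell\ge0}$ be indeterminates, and for $n\ge0$ define $$M_n(\mathsf a,\mathsf b)=\sum_{\pi\in\mathcal M_{2n}}\;\prod_{i\in\mathrm{openers}}\mathsf a_{\mathrm{cr}(i,\pi),\,\mathrm{ne}(i,\pi)}\prod_{i\in\mathrm{closers}}\mathsf b_{\mathrm{qne}(i,\pi)},$$ where $\mathcal M_{2n}$ is the set of perfect matchings of $[2n]$. Then $$\sum_{n=0}^\infty M_n(\mathsf a,\mathsf b)\,t^n=\cfrac{1}{1-\cfrac{\alpha_1t}{1-\cfrac{\alpha_2t}{1-\cfrac{\alpha_3t}{1-\cdots}}}}$$ with coefficients, for $n\ge1$, $$\alpha_n=\mathsf a^\star_{n-1}\,\mathsf b_{n-1},\qquad\text{where }\mathsf a^\star_{n-1}=\sum_{\ell=0}^{n-1}\mathsf a_{\ell,n-1-\ell}.$$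
   Context: A perfect matching of $[2n]=\{1,\dots,2n\}$ is a partition $\pi$ of $[2n]$ in which every block has size 2. Continued fractions are identities of formal power series in $t$. The opener (resp. closer) of a block is its smaller (resp. larger) element. $\mathcal G_\pi$ is the graph on $[2n]$ whose edges are the blocks of $\pi$, each written as a pair $(i,j)$ with $i<j$. For $j\in[2n]$ define $\mathrm{cr}(j,\pi)=\#\{i<j<k<l:\ (i,k)\in\mathcal G_\pi,\ (j,l)\in\mathcal G_\pi\}$, $\mathrm{ne}(j,\pi)=\#\{i<j<k<l:\ (i,l)\in\mathcal G_\pi,\ (j,k)\in\mathcal G_\pi\}$, $\mathrm{qne}(j,\pi)=\#\{i<j<l:\ (i,l)\in\mathcal G_\pi\}$ (in each case $j$ is fixed and the other indices vary). *)

(* Defs.v *)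
From mathcomp Require Import all_boot all_algebra.

Set Implicit Arguments.
Unset Strict Implicit.
Unset Printing Implicit Defensive.

Import GRing.Theory.
Local Open Scope ring_scope.

(* A formal power series in t over R is its coefficient sequence. *)
Section FormalPowerSeries.
Variable R : comNzRingType.

Definition fps := nat -> R.

Definition fps_one : fps := fun n => (n == 0%N)%:R.

Definition fps_sub (f g : fps) : fps := fun n => f n - g n.

Definition fps_mul (f g : fps) : fps :=
  fun n => \sum_(i < n.+1) f i * g (n - i)%N.

Definition fps_exp (f : fps) (k : nat) : fps := iter k (fps_mul f) fps_one.

Definition fps_monom (c : R) (m : nat) : fps := fun n => c *+ (n == m).

(* Multiplicative inverse of a series f with constant term 1, by the geometric
   expansion f^-1 = \sum_k (1 - f)^k; since 1 - f has no constant term, only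
   k <= n contributes to the coefficient of t^n.  See fps_mulfV. *)
Definition fps_inv (f : fps) : fps :=
  fun n => \sum_(k < n.+1) fps_exp (fps_sub fps_one f) k n.

(* Convergence of a sequence of series in the t-adic topology. *)
Definition fps_cvg (u : nat -> fps) (f : fps) : Prop :=
  forall n, exists K, forall k, (K <= k)%N -> u k n = f n.

(* sfrac alpha i m = 1/(1 - alpha_i t/(1 - alpha_{i+1} t/(... /(1 - alpha_{i+m-1} t)))). *)
Fixpoint sfrac (alpha : nat -> R) (i m : nat) : fps :=
  if m is m'.+1 then
    fps_inv (fps_sub fps_one
      (fps_mul (fps_monom (alpha i) 1) (sfrac alpha i.+1 m')))
  else fps_one.

(* f is the infinite continued fraction 1/(1 - alpha_1 t/(1 - alpha_2 t/...)),
   i.e. the limit of its truncations; alpha 0 is not used. *)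
Definition is_Sfraction (f : fps) (alpha : nat -> R) : Prop :=
  fps_cvg (sfrac alpha 1) f.

Lemma fps_exp_small (g : fps) k n : g 0%N = 0 -> (n < k)%N -> fps_exp g k n = 0.
Proof.
move=> g0; elim: k n => // k IH n lt_nk.
rewrite /fps_exp iterS -/(fps_exp g k) /fps_mul big1 // => -[[|i] lti] _ /=.
  by rewrite g0 mul0r.
rewrite IH ?mulr0 //; apply: (@leq_trans n) => //; rewrite ltn_subLR //.
by rewrite addSn ltnS leq_addl.
Qed.

Lemma fps_mulfV (f : fps) : f 0%N = 1 -> fps_mul f (fps_inv f) =1 fps_one.
Proof.
move=> f0 n; pose g := fps_sub fps_one f.
have g0 : g 0%N = 0 by rewrite /g /fps_sub f0 subrr.
have fE i : f i = fps_one i - g i by rewrite /g /fps_sub subKr.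
rewrite /fps_mul; under eq_bigr => i _ do rewrite fE mulrBl.
rewrite sumrB big_ord_recl /= mul1r subn0 big1 ?addr0; last first.
  by move=> i _; rewrite /fps_one /= mul0r.
suff -> : \sum_(i < n.+1) g i * fps_inv f (n - i)%N
        = \sum_(k < n.+1) fps_exp g k.+1 n.
  rewrite /fps_inv -/g [X in X - _]big_ord_recl [X in _ - X]big_ord_recr /=.
  rewrite -[fps_mul g _ n]/(fps_exp g n.+1 n) fps_exp_small // addr0.
  by rewrite addrK.
have extend i : fps_inv f (n - i)%N = \sum_(k < n.+1) fps_exp g k (n - i)%N.
  rewrite /fps_inv -/g -!(big_mkord xpredT (fun k => fps_exp g k (n - i)%N)).
  rewrite (@big_cat_nat _ _ _ (n - i).+1 0 n.+1) ?ltnS ?leq_subr //=.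
  rewrite [X in _ = _ + X]big_nat [X in _ = _ + X]big1 ?addr0 // => k /andP[lt_k _].
  by rewrite fps_exp_small.
under eq_bigr => i _ do rewrite extend mulr_sumr.
by rewrite exchange_big.
Qed.

End FormalPowerSeries.

(* The ground set [m] = {1,...,m} is represented by 'I_m = {0,...,m-1}; only
   the relative order of the points matters below. *)
Section Matchings.
Variable m : nat.
Implicit Types (pi : {set {set 'I_m}}) (i j : 'I_m).

Definition perfect_matching pi : bool :=
  partition pi [set: 'I_m] && [forall B in pi, #|B| == 2].

Definition edge pi i j : bool := (i < j)%N && ([set i; j] \in pi).

Definition opener pi i : bool := [exists j, edge pi i j].

Definition closer pi j : bool := [exists i, edge pi i j].

Definition cr j pi : nat :=
  #|[set x : 'I_m * 'I_m * 'I_m | let: (i, k, l) := x in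
      [&& (i < j)%N, (j < k)%N, (k < l)%N, edge pi i k & edge pi j l]]|.

Definition ne j pi : nat :=
  #|[set x : 'I_m * 'I_m * 'I_m | let: (i, k, l) := x in
      [&& (i < j)%N, (j < k)%N, (k < l)%N, edge pi i l & edge pi j k]]|.

Definition qne j pi : nat :=
  #|[set x : 'I_m * 'I_m | let: (i, l) := x in
      [&& (i < j)%N, (j < l)%N & edge pi i l]]|.

End Matchings.

Definition M (R : comNzRingType) (a : nat -> nat -> R) (b : nat -> R) (n : nat) : R :=
  \sum_(pi : {set {set 'I_(2 * n)}} | perfect_matching pi)
    (\prod_(i : 'I_(2 * n) | opener pi i) a (cr i pi) (ne i pi)) *
    (\prod_(i : 'I_(2 * n) | closer pi i) b (qne i pi)).

Definition astar (R : comNzRingType) (a : nat -> nat -> R) (n : nat) : R :=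
  \sum_(l < n.+1) a l (n - l)%N.

(* Main.v *)
Require Import Defs.
From mathcomp Require Import all_boot all_algebra.
Import GRing.Theory.
Local Open Scope ring_scope.

(** Read a perfect matching from right to left.  At each moment some closers
    have been read whose openers have not; call them pending.  A suffix of a
    matching is thus an involution of its points whose fixed points are the
    pending closers, and each statistic at a point j depends only on the part
    of the matching at and after j: if j is an opener, it picks one pending
    closer, and cr (resp. ne) counts the pending closers to the left (resp.
    right) of the picked one; if j is a closer, qne counts the closers pending
    when j is read.

    Let T k p be the weighted sum over involutions of k points with p fixed
    points.  Deleting the leftmost point gives
      T (k+1) p = b_(p-1) T k (p-1) + astar_p T k (p+1),
    without the first term if p = 0, because an opener facing p+1 pending
    closers can pick the one of any rank r <= p, which contributes a_(r, p-r),
    and these weights add up to astar_p ([involution_sumS0],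
    [involution_sumSS]).  Fixed-point-free involutions are the perfect
    matchings, so M_n = T (2n) 0 ([M_involution_sum]).

    It remains to see that such a recurrence yields an S-fraction
    ([Sfraction_of_recurrence]).  This is the Euler-Gauss recurrence method: if
    S_i is the continued fraction that starts at alpha_i, then
    S_i = 1 + alpha_i t S_(i+1) S_i, so the products G_p = S_1 ... S_p satisfy
    G_(p+1) = G_p + alpha_(p+1) t G_(p+2).  Up to the factor b_0 ... b_(p-1),
    the coefficients of G_(p+1) obey the recurrence of T, whence
      T (2n+p) p = b_0 ... b_(p-1) [t^n] G_(p+1),
    and p = 0 is the claim. *)

Set Implicit Arguments.
Unset Strict Implicit.
Unset Printing Implicit Defensive.

(** * Euler-Gauss recurrences and S-fractions *)

Section Series.
Variable R : comNzRingType.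
Implicit Types f g h : fps R.

(** Truncation to polynomials gives the Cauchy product its ring laws. *)
Lemma fps_mul_poly f g N n : (n < N)%N ->
  fps_mul f g n = ((\poly_(i < N) f i) * (\poly_(i < N) g i))`_n.
Proof.
move=> nN; rewrite coefM; apply: eq_bigr => -[i /= le_in] _.
rewrite !coef_poly (leq_ltn_trans (leq_subr i n) nN).
by rewrite (leq_ltn_trans _ nN) // -ltnS.
Qed.

Lemma eq_coefM (p p' q q' : {poly R}) n :
    (forall i, (i <= n)%N -> p`_i = p'`_i) ->
    (forall i, (i <= n)%N -> q`_i = q'`_i) ->
  (p * q)`_n = (p' * q')`_n.
Proof.
move=> pp' qq'; rewrite !coefM; apply: eq_bigr => -[i /= le_in] _.
by rewrite pp' ?qq' ?leq_subr // -ltnS.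
Qed.

Lemma fps_mulC f g n : fps_mul f g n = fps_mul g f n.
Proof. by rewrite !(fps_mul_poly _ _ (ltnSn n)) mulrC. Qed.

Lemma fps_mulA f g h n :
  fps_mul f (fps_mul g h) n = fps_mul (fps_mul f g) h n.
Proof.
pose P u := \poly_(i < n.+1) (u : fps R) i.
have PM u v i : (i <= n)%N -> (P (fps_mul u v))`_i = (P u * P v)`_i.
  by move=> le_in; rewrite coef_poly ltnS le_in (fps_mul_poly _ _ (N := n.+1)).
rewrite !(fps_mul_poly _ _ (ltnSn n)) -!/(P _).
rewrite (@eq_coefM _ (P f) _ (P g * P h)) //; last by move=> i; apply: PM.
by rewrite mulrA; apply: eq_coefM => // i le_in; rewrite PM.
Qed.

Lemma fps_mul1f f n : fps_mul (@fps_one R) f n = f n.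
Proof.
rewrite /fps_mul big_ord_recl mul1r subn0 big1 ?addr0 // => i _.
by rewrite mul0r.
Qed.

(** The relation g = 1 + c t h g is stable under multiplication by f; it is
    stated on coefficients, where multiplication by t is an index shift. *)
Lemma fps_mulSr f g h c n : g 0%N = 1 ->
    (forall j, g j.+1 = c * fps_mul h g j) ->
  fps_mul f g n.+1 = f n.+1 + c * fps_mul (fps_mul f g) h n.
Proof.
move=> g0 gS; rewrite {1}/fps_mul big_ord_recr /= subnn g0 mulr1 addrC.
congr (_ + _); rewrite -fps_mulA {1}/fps_mul mulr_sumr.
apply: eq_bigr => -[i /= le_in] _.
by rewrite subSn // gS fps_mulC mulrCA.
Qed.

Lemma sfrac0 alpha i m : @sfrac R alpha i m 0 = 1.
Proof. by case: m => // m; rewrite /= /fps_inv big_ord1. Qed.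

(** The coefficients of S = 1 + alpha_i t S' S, which is what it means for
    S to be the inverse of 1 - alpha_i t S'. *)
Lemma sfracS (alpha : nat -> R) i m n :
  sfrac alpha i m.+1 n.+1 =
    alpha i * fps_mul (sfrac alpha i.+1 m) (sfrac alpha i m.+1) n.
Proof.
set S := sfrac alpha i.+1 m; set V := sfrac alpha i m.+1.
pose u := fps_mul (fps_monom (alpha i) 1) S.
have u0 : u 0%N = 0 by rewrite /u /fps_mul big_ord1 /fps_monom /= mul0r.
have uS j : u j.+1 = alpha i * S j.
  rewrite /u /fps_mul 2!big_ord_recl big1 => [|k _]; last by rewrite mul0r.
  by rewrite /fps_monom /= mul0r add0r addr0 subSS subn0.
have /(_ n.+1) : fps_mul (fps_sub (@fps_one R) u) V =1 @fps_one R.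
  by apply: fps_mulfV; rewrite /fps_sub u0 subr0.
rewrite {1}/fps_mul big_ord_recl {1}/fps_sub u0 subr0 mul1r subn0.
move/(canRL (addrK _)) => ->; rewrite /fps_one /= sub0r -sumrN mulr_sumr.
apply: eq_bigr => j _.
by rewrite /fps_sub /fps_one /= uS sub0r mulNr opprK mulrA subSS.
Qed.

(** The truncation of S_1 ... S_p in which the factor S_(q+1) has depth K - q:
    all factors stop at the same level K, so that expanding the last factor by
    [sfracS] produces the next product exactly. *)
Fixpoint sfrac_prod (alpha : nat -> R) (K p : nat) : fps R :=
  if p is q.+1 then
    fps_mul (sfrac_prod alpha K q) (sfrac alpha q.+1 (K - q))
  else @fps_one R.

Lemma sfrac_prod0 alpha K p : sfrac_prod alpha K p 0 = 1.
Proof.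
by elim: p => //= p IH; rewrite /fps_mul big_ord1 sfrac0 mulr1.
Qed.

Lemma sfrac_prodS alpha K p n : (p < K)%N ->
  sfrac_prod alpha K p.+1 n.+1 =
    sfrac_prod alpha K p n.+1 + alpha p.+1 * sfrac_prod alpha K p.+2 n.
Proof.
move=> lt_pK /=; rewrite -(subnSK lt_pK); apply: fps_mulSr => [|j].
  exact: sfrac0.
exact: sfracS.
Qed.

(** T k p enumerates weighted lattice paths of k steps from height p to 0, where
    c_p weights a rise from p and b_p a descent to p.  On truncations, the
    formula T (2n+p) p = b_0 ... b_(p-1) [t^n] S_1 ... S_(p+1) is exact as soon
    as n + p <= K: a path counted by T (2n+p) p has n rises, so it stays at
    height at most n + p and involves only alpha_1, ..., alpha_(n+p). *)
Lemma Sfraction_of_recurrence (T : nat -> nat -> R) (b c alpha : nat -> R) :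
    (forall p, T 0%N p = (p == 0%N)%:R) ->
    (forall k, T k.+1 0%N = c 0%N * T k 1%N) ->
    (forall k p, T k.+1 p.+1 = b p * T k p + c p.+1 * T k p.+2) ->
    (forall p, alpha p.+1 = c p * b p) ->
  is_Sfraction (fun n => T (2 * n)%N 0%N) alpha.
Proof.
move=> T0 TS0 TSS alphaE.
  (* A path needs at least p steps to come down from height p. *)
have Tlow k p : (k < p)%N -> T k p = 0.
  elim: k p => [|k IH] [|p] //.
  rewrite ltnS => lt_kp; rewrite TSS (IH p) // (IH p.+2) ?mulr0 ?add0r //.
  exact: leq_trans lt_kp (leqW (leqnSn p)).
suff TE K k n p : k = (2 * n + p)%N -> (n + p <= K)%N ->
    T k p = (\prod_(i < p) b i) * sfrac_prod alpha K p.+1 n.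
  move=> n; exists n => K le_nK; rewrite (TE K _ n) ?addn0 //.
  by rewrite big_ord0 mul1r /= fps_mul1f subn0.
elim: k n p => [|k IH] n p Ek leK.
  have [-> ->] : n = 0%N /\ p = 0%N by case: n p Ek {leK} => [|n] [|p].
  by rewrite T0 big_ord0 mul1r sfrac_prod0.
case: n => [|n] in Ek leK *.
  case: p => [|p] // in Ek leK *.
  have {}Ek : k = p by move: Ek; rewrite muln0 => -[].
  rewrite TSS (Tlow k p.+2) ?mulr0 ?addr0; last by rewrite Ek.
  rewrite (IH 0%N p) ?muln0 ?(ltnW leK) //.
  by rewrite big_ord_recr !sfrac_prod0 !mulr1 mulrC.
have Ek' : k = (2 * n + p.+1)%N.
  by apply: succn_inj; rewrite Ek mulnS addnS.
have leK' : (n + p.+1 <= K)%N by rewrite addnS -addSn.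
have lt_pK : (p < K)%N by rewrite (leq_trans _ leK') // leq_addl.
rewrite sfrac_prodS // mulrDr; case: p => [|p] in Ek leK Ek' leK' lt_pK *.
  rewrite TS0 (IH n 1%N) // alphaE !big_ord0 big_ord1 !mul1r add0r.
  by rewrite mulrA.
rewrite TSS (IH n.+1 p); last 2 first.
- by apply: succn_inj; rewrite Ek addnS.
- by rewrite (leq_trans _ leK) // leq_add2l.
rewrite (IH n p.+2) //; congr (_ + _).
  by rewrite [in RHS]big_ord_recr /= mulrA [b p * _]mulrC.
by rewrite alphaE [in LHS]big_ord_recr /= mulrA mulrCA !mulrA.
Qed.

End Series.

(** * Involutions with fixed points and their recurrence *)

(** Summing over the elements of P a function of their rank in P amounts to
    summing over all ranks. *)
Lemma sum_by_rank (V : nmodType) k (P : pred 'I_k) (F : nat -> V) :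
  \sum_(l | P l) F (\sum_(i < k) (P i && (i < l)))%N
    = \sum_(r < \sum_(l < k) P l) F r.
Proof.
elim: k P => [|k IH] P; first by rewrite !big_ord0.
pose P' (i : 'I_k) := P (widen_ord (leqnSn k) i).
have rank l : (l <= k)%N ->
    (\sum_(i < k.+1) (P i && (i < l)) = \sum_(i < k) (P' i && (i < l)))%N.
  by move=> le_lk; rewrite big_ord_recr /= ltnNge le_lk andbF addn0.
rewrite big_mkcond big_ord_recr /= [in RHS]big_ord_recr /=.
under eq_bigr => i _ do rewrite rank 1?ltnW //.
rewrite -big_mkcond (IH P') rank //=.
have -> : (\sum_(i < k) (P' i && (i < k)) = \sum_(i < k) P' i)%N.
  by apply: eq_bigr => i _; rewrite ltn_ord andbT.
by case: (P ord_max); rewrite ?addn1 ?big_ord_recr //= addn0 addr0.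
Qed.

Section Involutions.
Variables (R : comNzRingType) (a : nat -> nat -> R) (b : nat -> R).

Section Statistics.
Variable k : nat.
Implicit Types (f : {ffun 'I_k -> 'I_k}) (j l : 'I_k).

Definition involutive_ff f := [forall i, f (f i) == i].

Definition fixpoints f := (\sum_(i < k) (f i == i))%N.

(** When the points are read from right to left and j is next, l is a closer
    already read and not yet matched: its opener lies left of j, or beyond the
    left end of the segment if l is fixed.  The partner of j itself is not
    counted. *)
Definition pending f j l := (j < l)%N && ((f l < j)%N || (f l == l)).

(** The sums are cr, ne and qne, with fixed points counted as arcs that enter
    from the left. *)
Definition step_weight f j : R :=
  if (j < f j)%N then
    a (\sum_(l < k) (pending f j l && (l < f j)))%N
      (\sum_(l < k) (pending f j l && (f j < l)))%N
  else b (\sum_(l < k) pending f j l)%N.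

Definition inv_weight f : R := \prod_j step_weight f j.

End Statistics.

Definition involution_sum k p : R :=
  \sum_(f : {ffun 'I_k -> 'I_k} | involutive_ff f && (fixpoints f == p))
    inv_weight f.

Section Extend.
Variable k : nat.
Implicit Types (f : {ffun 'I_k.+1 -> 'I_k.+1}) (g : {ffun 'I_k -> 'I_k}).
Implicit Types (o : 'I_k.+1) (i j l : 'I_k).

(** Adds a new leftmost point to g: it is matched to the old point o, which must
    be a fixed point of g, or becomes a fixed point itself if o = ord0. *)
Definition extend (x : {ffun 'I_k -> 'I_k} * 'I_k.+1)
    : {ffun 'I_k.+1 -> 'I_k.+1} :=
  [ffun i => if unlift ord0 i is Some j
             then if lift ord0 j == x.2 then ord0 else lift ord0 (x.1 j)
             else x.2].

(** Deletes the leftmost point.  The default j turns the old partner of that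
    point into a fixed point, that is, into a pending closer again. *)
Definition restrict f : {ffun 'I_k -> 'I_k} * 'I_k.+1 :=
  ([ffun j => odflt j (unlift ord0 (f (lift ord0 j)))], f ord0).

Definition admissible (x : {ffun 'I_k -> 'I_k} * 'I_k.+1) :=
  involutive_ff x.1 && [forall l, (lift ord0 l == x.2) ==> (x.1 l == l)].

Lemma extend0 g o : extend (g, o) ord0 = o.
Proof. by rewrite ffunE unlift_none. Qed.

Lemma extend_lift g o j :
  extend (g, o) (lift ord0 j) =
    if lift ord0 j == o then ord0 else lift ord0 (g j).
Proof. by rewrite ffunE liftK. Qed.

Lemma restrictK f : involutive_ff f -> extend (restrict f) = f.
Proof.
move/forallP => ff; apply/ffunP => i; rewrite ffunE /=.
case: unliftP => [j|] -> //.
case: eqP => [-> | ne_j0]; first by rewrite (eqP (ff _)).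
rewrite ffunE; case: unliftP => [l|] fj //.
by case: ne_j0; move: (eqP (ff (lift ord0 j))); rewrite fj.
Qed.

(** With [restrictK], this makes [extend] a bijection from admissible pairs onto
    involutions, in the form needed to reindex a sum. *)
Lemma extend_involutive x :
  involutive_ff (extend x) && (restrict (extend x) == x) = admissible x.
Proof.
case: x => g o; apply/andP/andP => /= -[].
  move/forallP => ff /eqP [/ffunP gE _].
  have fix_o l : lift ord0 l == o -> g l = l.
    by move=> lo; rewrite -gE ffunE extend_lift lo unlift_none.
  split; last by apply/forallP => l; apply/implyP => /fix_o ->.
  apply/forallP => j; have [/eqP lo | nlo] := boolP (lift ord0 j == o).
    by rewrite !fix_o // lo.
  have /eqP := ff (lift ord0 j); rewrite extend_lift (negPf nlo) extend_lift.
  by case: eqP => // _ /lift_inj ->.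
move=> /forallP gg /forallP fix_o; split.
  apply/forallP => i; case: (unliftP ord0 i) => [j|] ->.
    rewrite extend_lift; case: (lift ord0 j =P o) => [-> | /eqP ne_jo].
      by rewrite extend0.
    rewrite extend_lift; case: (lift ord0 (g j) =P o) => [lo | _];
      last by rewrite (eqP (gg j)).
    have /eqP := implyP (fix_o (g j)) (introT eqP lo).
    by rewrite (eqP (gg j)) => gj; rewrite gj lo eqxx in ne_jo.
  rewrite extend0; case: (unliftP ord0 o) => [j|] oE; last by rewrite oE extend0.
  by rewrite oE extend_lift eqxx.
apply/eqP; congr (_, _); last by rewrite extend0.
apply/ffunP => j; rewrite ffunE extend_lift; case: ifP => jo.
  by rewrite unlift_none /= (eqP (implyP (fix_o j) jo)).
by rewrite liftK.
Qed.

Lemma pending_extend g o j l : admissible (g, o) ->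
  pending (extend (g, o)) (lift ord0 j) (lift ord0 l) = pending g j l.
Proof.
case/andP => /= _ /forallP/(_ l); rewrite /pending extend_lift.
case: eqP => [lo /eqP gl | _ _].
  by rewrite !lift0 gl eqxx !orbT.
by rewrite (inj_eq lift_inj) !lift0.
Qed.

(** The weight of an old point is unaffected by the new one: a point picked by
    the new leftmost opener was pending as a fixed point and remains pending
    with an opener left of every old point. *)
Lemma step_weight_lift g o j : admissible (g, o) ->
  step_weight (extend (g, o)) (lift ord0 j) = step_weight g j.
Proof.
move=> adm; have Sp (P : pred 'I_k.+1) :
  (\sum_(l < k.+1) (pending (extend (g, o)) (lift ord0 j) l && P l) =
    \sum_(l < k) (pending g j l && P (lift ord0 l)))%N.
  rewrite big_ord_recl {1}/pending !andFb add0n.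
  by apply: eq_bigr => l _; rewrite pending_extend.
have E0 : (\sum_(l < k.+1) pending (extend (g, o)) (lift ord0 j) l =
    \sum_(l < k) pending g j l)%N.
  rewrite big_ord_recl {1}/pending !andFb add0n.
  by apply: eq_bigr => l _; rewrite pending_extend.
rewrite /step_weight E0 !Sp extend_lift.
case/andP: adm => /= _ /forallP/(_ j); case: eqP => [jo /eqP gj | _ _].
  by rewrite gj ltnn.
by rewrite !lift0 ltnS.
Qed.

Lemma inv_weight_extend g o : admissible (g, o) ->
  inv_weight (extend (g, o)) =
    step_weight (extend (g, o)) ord0 * inv_weight g.
Proof.
move=> adm; rewrite /inv_weight big_ord_recl; congr (_ * _).
by apply: eq_bigr => j _; rewrite step_weight_lift.
Qed.

Lemma pending_extend0 g o l : admissible (g, o) ->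
  pending (extend (g, o)) ord0 (lift ord0 l) =
    (g l == l) && (lift ord0 l != o).
Proof.
move=> /andP[/= _ /forallP/(_ l)]; rewrite /pending extend_lift.
case: eqP => _ _; first by rewrite !andbF.
by rewrite (inj_eq lift_inj) andbT.
Qed.

Lemma admissible0 g : admissible (g, ord0) = involutive_ff g.
Proof. by rewrite /admissible /= andb_idr // => _; apply/forallP. Qed.

Lemma admissible_lift g l :
  admissible (g, lift ord0 l) = involutive_ff g && (g l == l).
Proof.
rewrite /admissible /=; congr (_ && _); apply/forallP/idP => [/(_ l)|gl i].
  by rewrite eqxx.
by rewrite (inj_eq lift_inj); apply/implyP => /eqP ->.
Qed.

Lemma fixpoints_split g l : g l == l ->
  fixpoints g = (\sum_(i < k) ((g i == i) && (i < l)) +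
                 \sum_(i < k) ((g i == i) && (l < i))).+1%N.
Proof.
move=> gl; have one : (\sum_(i < k) (i == l) = 1)%N.
  by rewrite (bigD1 l) //= eqxx big1 // => i /negPf ->.
rewrite -addn1 -[1%N]one -!big_split; apply: eq_bigr => i _ /=.
have [-> | ne_il] := eqVneq i l; first by rewrite gl ltnn.
by case: ltngtP => [||/val_inj eq_il]; rewrite ?andbT ?andbF ?addn0 //;
   rewrite eq_il eqxx in ne_il.
Qed.

Lemma fixpoints_extend0 g : fixpoints (extend (g, ord0)) = (fixpoints g).+1.
Proof.
rewrite /fixpoints big_ord_recl extend0 eqxx add1n; congr _.+1.
by apply: eq_bigr => i _; rewrite extend_lift (inj_eq lift_inj).
Qed.

Lemma fixpoints_extend_lift g l : g l == l ->
  (fixpoints (extend (g, lift ord0 l))).+1 = fixpoints g.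
Proof.
move=> gl; rewrite /fixpoints big_ord_recl extend0 add0n.
rewrite (bigD1 l) //= [in RHS](bigD1 l) //= gl.
rewrite extend_lift eqxx add0n add1n; congr _.+1; apply: eq_bigr => i ne_il.
by rewrite extend_lift (inj_eq lift_inj) (negPf ne_il) (inj_eq lift_inj).
Qed.

Lemma step_weight_extend0 g : involutive_ff g ->
  step_weight (extend (g, ord0)) ord0 = b (fixpoints g).
Proof.
move=> gg; rewrite /step_weight extend0 ltnn big_ord_recl add0n.
congr (b _); apply: eq_bigr => l _.
by rewrite pending_extend0 ?admissible0 // andbT.
Qed.

(** Apart from the picked closer l, the pending closers are the other fixed
    points of g; ne is thus determined by cr. *)
Lemma step_weight_extend_lift g l : involutive_ff g -> g l == l ->
  step_weight (extend (g, lift ord0 l)) ord0 =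
    a (\sum_(i < k) ((g i == i) && (i < l)))%N
      ((fixpoints g).-1 - \sum_(i < k) ((g i == i) && (i < l)))%N.
Proof.
move=> gg gl; have adm : admissible (g, lift ord0 l).
  by rewrite admissible_lift gg.
rewrite (fixpoints_split gl) /= addKn /step_weight extend0 lift0 /=.
congr (a _ _); rewrite big_ord_recl add0n; apply: eq_bigr => i _;
  rewrite pending_extend0 // (inj_eq lift_inj) lift0 ltnS -andbA;
  congr (nat_of_bool (_ && _)); have [->|] := eqVneq i l; rewrite ?ltnn //.
Qed.

End Extend.

Lemma involution_sum0 p : involution_sum 0 p = (p == 0%N)%:R.
Proof.
rewrite /involution_sum; have all1 (f : {ffun 'I_0 -> 'I_0}) : f = [ffun i => i].
  by apply/ffunP => -[].
case: p => [|p] /=.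
  rewrite (big_pred1 [ffun i => i]) => [|f].
    by rewrite /inv_weight big_ord0.
  rewrite /= [f]all1 eqxx /fixpoints big_ord0 andbT.
  by apply/forallP => -[].
by rewrite big1 // => f; rewrite /fixpoints big_ord0 andbF.
Qed.

(** The leftmost point is a new pending closer, or an opener that picks one of
    p + 1 pending closers.  In the second case the rank of the choice runs over
    all of 0, ..., p, which is where the sum astar comes from. *)
Lemma involution_sum_split k p :
  involution_sum k.+1 p =
    \sum_(g : {ffun 'I_k -> 'I_k} | involutive_ff g && ((fixpoints g).+1 == p))
       b (fixpoints g) * inv_weight g +
    \sum_(g : {ffun 'I_k -> 'I_k} | involutive_ff g && (fixpoints g == p.+1))
       astar a p * inv_weight g.
Proof.
rewrite /involution_sum (reindex_onto (@extend k) (@restrict k)) /=; last first.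
  by move=> f /andP[ff _]; apply: restrictK.
under eq_bigl => x do rewrite andbAC extend_involutive.
rewrite big_mkcond /= -(pair_bigA _ (fun g o =>
  if admissible (g, o) && (fixpoints (extend (g, o)) == p)
  then inv_weight (extend (g, o)) else 0)) /=.
under eq_bigr => g _ do rewrite big_ord_recl.
rewrite big_split /= [in RHS]big_mkcond [X in _ = _ + X]big_mkcond /=.
congr (_ + _); apply: eq_bigr => g _.
  rewrite admissible0 fixpoints_extend0; case: ifP => // /andP[gg _].
  by rewrite inv_weight_extend ?admissible0 // step_weight_extend0.
have [gg | ngg] /= := boolP (involutive_ff g); last first.
  by rewrite big1 // => l _; rewrite admissible_lift (negPf ngg).
case: ifP => [/eqP fixg | nfix]; last first.
  rewrite big1 // => l _; rewrite admissible_lift gg /=.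
  case: ifP => // /andP[gl /eqP fixE].
  by rewrite -(fixpoints_extend_lift gl) fixE eqxx in nfix.
pose F r := a r (p - r)%N.
have -> : astar a p = \sum_(r < fixpoints g) F r by rewrite fixg.
rewrite /fixpoints -(sum_by_rank (fun l => g l == l)) mulr_suml [RHS]big_mkcond.
apply: eq_bigr => l _; rewrite admissible_lift gg /=.
have [gl | //] := boolP (g l == l).
rewrite -eqSS fixpoints_extend_lift // fixg eqxx inv_weight_extend; last first.
  by rewrite admissible_lift gg.
by rewrite step_weight_extend_lift // fixg.
Qed.

Lemma involution_sumS0 k :
  involution_sum k.+1 0 = astar a 0 * involution_sum k 1.
Proof.
rewrite involution_sum_split big1 ?add0r ?mulr_sumr // => g.
by rewrite andbF.
Qed.

Lemma involution_sumSS k p :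
  involution_sum k.+1 p.+1 =
    b p * involution_sum k p + astar a p.+1 * involution_sum k p.+2.
Proof.
rewrite involution_sum_split /involution_sum !mulr_sumr; congr (_ + _).
by apply: eq_bigr => g /andP[_ /eqP[->]].
Qed.

End Involutions.

(** * Perfect matchings as fixed-point-free involutions *)

Lemma sum_bool_card (T : finType) (P : pred T) : (\sum_l P l)%N = #|P|.
Proof.
rewrite -sum1_card [RHS]big_mkcond; apply: eq_bigr => l _.
by rewrite unfold_in; case: (P l).
Qed.

Section Partners.
Variable m : nat.
Implicit Types (f : {ffun 'I_m -> 'I_m}) (pi : {set {set 'I_m}}).
Implicit Types (i j l : 'I_m).

Definition matching_of f : {set {set 'I_m}} := [set [set i; f i] | i : 'I_m].

Definition partner pi : {ffun 'I_m -> 'I_m} :=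
  [ffun i => odflt i [pick j | ([set i; j] \in pi) && (j != i)]].

Lemma fixpoints_eq0P f : reflect (forall i, f i != i) (fixpoints f == 0)%N.
Proof.
rewrite /fixpoints sum_nat_eq0; apply: (iffP forallP) => H i.
  by have := H i; case: (f i == i).
by rewrite (negPf (H i)).
Qed.

Lemma set2_inj i j l : [set i; j] = [set i; l] -> j != i -> j = l.
Proof.
move=> E ne_ji; have : j \in [set i; l] by rewrite -E set22.
by rewrite in_set2 (negPf ne_ji) => /eqP.
Qed.

Section MatchingToInvolution.
Variable pi : {set {set 'I_m}}.
Hypothesis pi_pm : perfect_matching pi.

Lemma partnerP i : [set i; partner pi i] \in pi /\ partner pi i != i.
Proof.
case/andP: pi_pm => /and3P[/eqP cov _ _] /forallP card2.
rewrite ffunE; case: pickP => [j /andP[] // | no_j].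
have /bigcupP[B Bpi iB] : i \in cover pi by rewrite cov inE.
have /implyP/(_ Bpi)/cards2P[x [y [ne_xy EB]]] := card2 B.
move: iB; rewrite EB !inE => /orP[]/eqP Ei.
  by have := no_j y; rewrite Ei -EB Bpi eq_sym ne_xy.
by have := no_j x; rewrite Ei setUC -EB Bpi ne_xy.
Qed.

Lemma partner_uniq i j : [set i; j] \in pi -> partner pi i = j.
Proof.
have [pi_i ne_i] := partnerP i => pi_ij.
case/andP: pi_pm => /and3P[_ /trivIsetP triv _] _.
apply: set2_inj ne_i; apply/eqP/negPn/negP => ne_B.
have /pred0P/(_ i) := triv _ _ pi_i pi_ij ne_B.
by rewrite /= !set21.
Qed.

Lemma partner_involutive : involutive_ff (partner pi).
Proof.
apply/forallP => i; apply/eqP/partner_uniq.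
by rewrite setUC; case: (partnerP i).
Qed.

Lemma partner_fixfree : fixpoints (partner pi) == 0%N.
Proof. by apply/fixpoints_eq0P => i; case: (partnerP i). Qed.

Lemma partnerK : matching_of (partner pi) = pi.
Proof.
apply/setP => B; apply/imsetP/idP => [[i _ ->]|Bpi].
  by case: (partnerP i).
case/andP: pi_pm => _ /forallP/(_ B)/implyP/(_ Bpi)/cards2P[x [y [_ EB]]].
by exists x => //; rewrite EB (@partner_uniq x y) // -EB.
Qed.

End MatchingToInvolution.

Section InvolutionToMatching.
Variable f : {ffun 'I_m -> 'I_m}.
Hypotheses (f_inv : involutive_ff f) (f_free : fixpoints f == 0%N).

Let fK i : f (f i) = i.
Proof. by have /forallP/(_ i)/eqP := f_inv. Qed.

Let f_neq i : f i != i.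
Proof. by have /fixpoints_eq0P := f_free. Qed.

Lemma mem_matching_of i j : ([set i; j] \in matching_of f) = (f i == j).
Proof.
apply/imsetP/eqP => [[x _ E] | <-]; last by exists i.
have : i \in [set x; f x] by rewrite -E set21.
rewrite in_set2 => /orP[]/eqP Ei; subst i.
  exact: set2_inj (esym E) (f_neq x).
by rewrite fK; rewrite [RHS]setUC in E; apply: set2_inj (esym E) _;
   rewrite eq_sym f_neq.
Qed.

Lemma matching_ofK : partner (matching_of f) = f.
Proof.
apply/ffunP => i; rewrite ffunE; case: pickP => [j|/(_ (f i))].
  by rewrite mem_matching_of => /andP[/eqP].
by rewrite mem_matching_of eqxx f_neq.
Qed.

Lemma matching_of_perfect : perfect_matching (matching_of f).
Proof.
apply/andP; split; last first.
  apply/forallP => B; apply/implyP => /imsetP[i _ ->].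
  by rewrite cards2 [i == _]eq_sym f_neq.
apply/and3P; split.
- apply/eqP/setP => i; rewrite inE; apply/bigcupP.
  by exists [set i; f i]; rewrite ?set21 // mem_matching_of.
- apply/trivIsetP => _ _ /imsetP[i _ ->] /imsetP[j _ ->].
  apply: contraR => /pred0Pn[x /=]; rewrite !in_set2 => /andP[].
  have block y : x == y \/ x == f y -> [set y; f y] = [set x; f x].
    by case=> /eqP -> //; rewrite fK setUC.
  by move=> /orP/block -> /orP/block ->.
- apply/imsetP => -[i _ /setP/(_ i)].
  by rewrite set21 inE.
Qed.

Lemma edge_matching_of i j :
  edge (matching_of f) i j = (i < j)%N && (f i == j).
Proof. by rewrite /edge mem_matching_of. Qed.

Lemma opener_matching_of i : opener (matching_of f) i = (i < f i)%N.
Proof.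
apply/existsP/idP => [[j]|lt_i].
  by rewrite edge_matching_of => /andP[? /eqP ->].
by exists (f i); rewrite edge_matching_of lt_i /=.
Qed.

Lemma closer_matching_of i : closer (matching_of f) i = ~~ (i < f i)%N.
Proof.
rewrite -leqNgt leq_eqVlt (inj_eq val_inj) (negPf (f_neq i)) /=.
apply/existsP/idP => [[j]|lt_i].
  by rewrite edge_matching_of => /andP[lt_j /eqP fj]; rewrite -fj fK fj.
by exists (f i); rewrite edge_matching_of lt_i fK /=.
Qed.

Let pendingE j l : pending f j l = (j < l)%N && (f l < j)%N.
Proof. by rewrite /pending (negPf (f_neq l)) orbF. Qed.

(** A crossing or nesting at j is determined by the closer of the other arc,
    since the remaining points of the triple are partners; the map h below is
    this parametrization. *)
Lemma cr_matching_of j : (j < f j)%N ->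
  cr j (matching_of f) = (\sum_(l < m) (pending f j l && (l < f j)))%N.
Proof.
move=> lt_j; pose h (l : 'I_m) := (f l, l, f j).
rewrite sum_bool_card -(@card_imset _ _ h); last by move=> x y [].
rewrite /cr; apply: eq_card => -[[i k] l]; rewrite inE !edge_matching_of.
apply/idP/imsetP => [/and5P[ij jk kl /andP[ik /eqP fi] /andP[jl /eqP fj]]|].
  exists k; last by rewrite /h -fi fK fj.
  by rewrite unfold_in pendingE -fi fK fi ij jk fj kl.
case=> x; rewrite unfold_in pendingE => /andP[/andP[jx fx] xj] [-> -> ->].
by rewrite fx jx xj fK !eqxx !andbT lt_j (ltn_trans fx jx).
Qed.

Lemma ne_matching_of j : (j < f j)%N ->
  ne j (matching_of f) = (\sum_(l < m) (pending f j l && (f j < l)))%N.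
Proof.
move=> lt_j; pose h (l : 'I_m) := (f l, f j, l).
rewrite sum_bool_card -(@card_imset _ _ h); last by move=> x y [].
rewrite /ne; apply: eq_card => -[[i k] l]; rewrite inE !edge_matching_of.
apply/idP/imsetP => [/and5P[ij jk kl /andP[il /eqP fi] /andP[_ /eqP fj]]|].
  exists l; last by rewrite /h -fi fK fj.
  by rewrite unfold_in pendingE -fi fK fi ij (ltn_trans jk kl) fj kl.
case=> x; rewrite unfold_in pendingE => /andP[/andP[jx fx] xj] [-> -> ->].
by rewrite fx lt_j xj fK !eqxx !andbT (ltn_trans fx jx).
Qed.

Lemma qne_matching_of j :
  qne j (matching_of f) = (\sum_(l < m) pending f j l)%N.
Proof.
pose h (l : 'I_m) := (f l, l).
rewrite (sum_bool_card (pending f j)) -(@card_imset _ _ h); last by move=> x y [].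
rewrite /qne; apply: eq_card => -[i l]; rewrite inE edge_matching_of.
apply/idP/imsetP => [/and4P[ij jl il /eqP fi]|].
  exists l; last by rewrite /h -fi fK.
  by rewrite -[l \in _]/(pending f j l) pendingE -fi fK fi ij jl.
case=> x; rewrite -[x \in _]/(pending f j x) pendingE => /andP[jx fx] [-> ->].
by rewrite fx jx fK eqxx andbT (ltn_trans fx jx).
Qed.

End InvolutionToMatching.
End Partners.

Lemma M_involution_sum (R : comNzRingType) a (b : nat -> R) n :
  M a b n = involution_sum a b (2 * n) 0.
Proof.
rewrite /M (reindex_onto (@matching_of _) (@partner _)) /=; last first.
  by move=> pi; apply: partnerK.
have condE f : perfect_matching (matching_of f) &&
    (partner (matching_of f) == f) =
    involutive_ff f && (fixpoints f == 0%N) :> bool.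
  apply/andP/andP => [[pm /eqP <-]|[f_inv f_free]].
    by rewrite partner_involutive // partner_fixfree.
  by rewrite matching_of_perfect // matching_ofK.
rewrite (eq_bigl _ _ (condE _)); apply: eq_bigr => f /andP[f_inv f_free].
rewrite /inv_weight big_mkcond [X in _ * X]big_mkcond -big_split /=.
apply: eq_bigr => i _; rewrite opener_matching_of // closer_matching_of //.
rewrite /step_weight; case: ifP => lt_i /=; last by rewrite mul1r qne_matching_of.
by rewrite mulr1 cr_matching_of // ne_matching_of.
Qed.

(** The path recurrence satisfied by the involution sums has rise weights
    [astar a] and descent weights b, hence coefficients astar_p b_p. *)
Theorem theorem4p5 :
  forall (R : comNzRingType) (a : nat -> nat -> R) (b : nat -> R)
    (alpha : nat -> R),
    (forall n : nat, (1 <= n)%N -> alpha n = astar a (n - 1) * b (n - 1)%N) ->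
    is_Sfraction (fun n : nat => M a b n) alpha.
Proof.
move=> R a b alpha alphaE n.
have [p|k|k p|p|K cvgK] :=
  @Sfraction_of_recurrence R (involution_sum a b) b (astar a) alpha _ _ _ _ n.
- exact: involution_sum0.
- exact: involution_sumS0.
- exact: involution_sumSS.
- by rewrite alphaE // subn1.
by exists K => k /cvgK ->; rewrite M_involution_sum.
Qed.
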